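(* Let $\{X_1,X_2,X_3,X_4,Z_1,Z_2,Z_3,Z_4\}$ be a basis of the real Lie algebra $\mathfrak{l}_4\oplus\mathfrak{l}_4$ with $$[X_1,X_3]=Z_1,\quad [X_2,X_4]=Z_2,\quad [X_1,Z_1]=Z_3,\quad [X_2,Z_2]=Z_4$$ (all brackets of basis elements not determined by these via antisymmetry being zero). For each $k\in\mathbb{N}$, the rational subspace generated by $$\{X_1+X_2,\ \sqrt{k}(X_1-X_2),\ X_3+X_4,\ \sqrt{k}(X_3-X_4),\ Z_1+Z_2,\ \sqrt{k}(Z_1-Z_2),\ Z_3+Z_4,\ \sqrt{k}(Z_3-Z_4)\}$$ is a rational form of $\mathfrak{l}_4\oplus\mathfrak{l}_4$ isomorphic to the rational Lie algebra $\mathfrak{l}_k^{\mathbb{Q}}$. Moreover, the set $$\{\mathfrak{l}_k^{\mathbb{Q}} : k\text{ is a square-free natural number}\}$$ parametrizes all the rational forms of $\mathfrak{l}_4\oplus\mathfrak{l}_4$ up to isomorphism: every rational form of $\mathfrak{l}_4\oplus\mathfrak{l}_4$ is isomorphic to $\mathfrak{l}_k^{\mathbb{Q}}$ for exactly one square-free natural number $k$.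
   Context: $\mathfrak{l}_4$ is the $4$-dimensional real Lie algebra with basis $Y_1,\dots,Y_4$ and brackets $[Y_1,Y_2]=Y_3$, $[Y_1,Y_3]=Y_4$ (others zero). For $k\in\mathbb{Z}$, $\mathfrak{l}_k^{\mathbb{Q}}$ is the rational Lie algebra with basis $X_1,\dots,X_4,Z_1,\dots,Z_4$ and brackets $[X_1,X_3]=Z_1$, $[X_1,X_4]=Z_2$, $[X_2,X_3]=Z_2$, $[X_2,X_4]=kZ_1$, $[X_1,Z_1]=Z_3$, $[X_1,Z_2]=Z_4$, $[X_2,Z_1]=Z_4$, $[X_2,Z_2]=kZ_3$ (others not determined by antisymmetry are zero). A rational form of a real Lie algebra $\mathfrak{n}$ of dimension $n$ is an $n$-dimensional $\mathbb{Q}$-subspace $\mathfrak{n}^{\mathbb{Q}}\subset\mathfrak{n}$, closed under the Lie bracket, with $\mathfrak{n}^{\mathbb{Q}}\otimes\mathbb{R}=\mathfrak{n}$. Two rational forms of $\mathfrak{n}$ are isomorphic if some automorphism of $\mathfrak{n}$ maps one onto the other, equivalently if they are isomorphic as Lie algebras over $\mathbb{Q}$. Here $\mathbb{N}=\{1,2,\dots\}$, and $k\in\mathbb{N}$ is square-free if $p^2\nmid k$ for every prime $p$ (so $1$ is square-free). *)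

(* Defs.v *)
From HB Require Import structures.
From mathcomp Require Import all_boot all_order all_algebra.
From mathcomp Require Import classical_sets reals.
From mathcomp Require Import ring.

Set Implicit Arguments.
Unset Strict Implicit.
Unset Printing Implicit Defensive.

Import Order.TTheory GRing.Theory Num.Theory.
Local Open Scope ring_scope.

HB.mixin Record Vector_isLie (F : fieldType) V of Vector F V := {
  lie : V -> V -> V;
  lie_linearl : forall (y : V) (a : F) (u v : V),
    lie (a *: u + v) y = a *: lie u y + lie v y;
  lie_linearr : forall (x : V) (a : F) (u v : V),
    lie x (a *: u + v) = a *: lie x u + lie x v;
  liexx : forall x : V, lie x x = 0;
  lie_jacobi : forall x y z : V,
    lie x (lie y z) + lie y (lie z x) + lie z (lie x y) = 0
}.

#[short(type="lieAlgType")]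
HB.structure Definition LieAlgebra (F : fieldType) :=
  { V of Vector F V & Vector_isLie F V }.

(* The direct sum, with the componentwise bracket. *)
Section DirectSum.
Variables (F : fieldType) (L1 L2 : lieAlgType F).
Implicit Types u v w : (L1 * L2)%type.

Definition prod_lie u v : (L1 * L2)%type := (lie u.1 v.1, lie u.2 v.2).

Fact prod_lie_linearl w (a : F) u v :
  prod_lie (a *: u + v) w = a *: prod_lie u w + prod_lie v w.
Proof. by rewrite /prod_lie /= !lie_linearl. Qed.

Fact prod_lie_linearr w (a : F) u v :
  prod_lie w (a *: u + v) = a *: prod_lie w u + prod_lie w v.
Proof. by rewrite /prod_lie /= !lie_linearr. Qed.

Fact prod_liexx u : prod_lie u u = 0.
Proof. by rewrite /prod_lie !liexx. Qed.

Fact prod_lie_jacobi u v w :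
  prod_lie u (prod_lie v w) + prod_lie v (prod_lie w u)
    + prod_lie w (prod_lie u v) = 0.
Proof.
by apply: (@injective_projections L1 L2); rewrite /= lie_jacobi.
Qed.

HB.instance Definition _ := Vector_isLie.Build F (L1 * L2)%type
  prod_lie_linearl prod_lie_linearr prod_liexx prod_lie_jacobi.

End DirectSum.

(* Provided that [c i j = 0] whenever [j <= i], this is the alternating bilinear
   product on row vectors such that [e_i, e_j] = c i j for all i < j, where
   e_1, ..., e_n is the standard basis, numbered from 1. *)
Section AltExt.
Variables (F : fieldType) (n : nat) (c : nat -> nat -> 'rV[F]_n).
Implicit Types x y u v : 'rV[F]_n.

Definition alt_ext x y : 'rV[F]_n :=
  \sum_(i < n) \sum_(j < n) (x 0 i * y 0 j - x 0 j * y 0 i) *: c i.+1 j.+1.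

Fact alt_ext_linearl y (a : F) u v :
  alt_ext (a *: u + v) y = a *: alt_ext u y + alt_ext v y.
Proof.
rewrite /alt_ext scaler_sumr -big_split; apply: eq_bigr => i _ /=.
rewrite scaler_sumr -big_split; apply: eq_bigr => j _ /=.
by rewrite !mxE scalerA -scalerDl; congr (_ *: _); ring.
Qed.

Fact alt_ext_linearr x (a : F) u v :
  alt_ext x (a *: u + v) = a *: alt_ext x u + alt_ext x v.
Proof.
rewrite /alt_ext scaler_sumr -big_split; apply: eq_bigr => i _ /=.
rewrite scaler_sumr -big_split; apply: eq_bigr => j _ /=.
by rewrite !mxE scalerA -scalerDl; congr (_ *: _); ring.
Qed.

Fact alt_extxx x : alt_ext x x = 0.
Proof.
rewrite /alt_ext big1 // => i _; rewrite big1 // => j _.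
by rewrite mulrC subrr scale0r.
Qed.

End AltExt.

Lemma alt_ext_inord (F : fieldType) (n : nat) (c : nat -> nat -> 'rV[F]_n.+1)
    (x y : 'rV[F]_n.+1) :
  alt_ext c x y = \sum_(0 <= i < n.+1) \sum_(0 <= j < n.+1)
    (x 0 (inord i) * y 0 (inord j) - x 0 (inord j) * y 0 (inord i))
      *: c i.+1 j.+1.
Proof.
rewrite big_mkord; apply: eq_bigr => i _; rewrite big_mkord.
by apply: eq_bigr => j _; rewrite !inord_val.
Qed.

(* Numbered from 1, as in [alt_ext]. *)
Definition ebasis (F : fieldType) (n i : nat) : 'rV[F]_n :=
  \row_(j < n) (j.+1 == i)%:R.

(* The basis Y_1, ..., Y_4 is the standard one. *)
Definition l4_table (F : fieldType) (i j : nat) : 'rV[F]_4 :=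
  match i, j with
  | 1%N, 2%N => ebasis F 4 3
  | 1%N, 3%N => ebasis F 4 4
  | _, _ => 0
  end.

Fact l4_jacobi (F : fieldType) (x y z : 'rV[F]_4) :
  let br := alt_ext (l4_table F) in
  br x (br y z) + br y (br z x) + br z (br x y) = 0.
Proof.
pose f (u v : 'rV[F]_4) m := u 0 (inord 0) * v 0 (inord m)
  - u 0 (inord m) * v 0 (inord 0).
have E u v : alt_ext (l4_table F) u v
    = f u v 1 *: ebasis F 4 3 + f u v 2 *: ebasis F 4 4.
  by rewrite alt_ext_inord unlock /= !scaler0 !(addr0, add0r).
have C u v m : (m < 4)%N ->
    alt_ext (l4_table F) u v 0 (inord m) = [:: 0; 0; f u v 1; f u v 2]`_m.
  move=> m4; rewrite E !mxE inordK //.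
  by case: m m4 => [|[|[|[|m]]]] // _ /=;
    rewrite ?(mulr0, mulr1, addr0, add0r).
move=> br; rewrite {}/br; apply/rowP => m; rewrite -(inord_val m).
move: (ltn_ord m); move: (m : nat) => {}m m4.
rewrite !mxE !C // /f !C //=.
case: m m4 => [|[|[|[|m]]]] // _ /=; rewrite ?addr0 /f //; ring.
Qed.

Definition l4 (F : fieldType) : Type := 'rV[F]_4.
HB.instance Definition _ (F : fieldType) := Vector.on (l4 F).
HB.instance Definition _ (F : fieldType) := Vector_isLie.Build F (l4 F)
  (alt_ext_linearl (l4_table F)) (alt_ext_linearr (l4_table F))
  (alt_extxx (l4_table F)) (@l4_jacobi F).

(* The basis X_1, ..., X_4, Z_1, ..., Z_4 is the standard one, in this order:
   the basis vectors numbered 5, ..., 8 are Z_1, ..., Z_4. *)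
Definition lk_table (k : int) (i j : nat) : 'rV[rat]_8 :=
  let Z m := ebasis rat 8 (4 + m) in
  match i, j with
  | 1%N, 3%N => Z 1%N
  | 1%N, 4%N => Z 2%N
  | 2%N, 3%N => Z 2%N
  | 2%N, 4%N => k%:~R *: Z 1%N
  | 1%N, 5%N => Z 3%N
  | 1%N, 6%N => Z 4%N
  | 2%N, 5%N => Z 4%N
  | 2%N, 6%N => k%:~R *: Z 3%N
  | _, _ => 0
  end.

Fact lk_jacobi (k : int) (x y z : 'rV[rat]_8) :
  let br := alt_ext (lk_table k) in
  br x (br y z) + br y (br z x) + br z (br x y) = 0.
Proof.
pose f (u v : 'rV[rat]_8) i j := u 0 (inord i) * v 0 (inord j)
  - u 0 (inord j) * v 0 (inord i).
pose q : rat := k%:~R.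
have E u v : alt_ext (lk_table k) u v
    = (f u v 0 2 + q * f u v 1 3) *: ebasis rat 8 5
    + (f u v 0 3 + f u v 1 2) *: ebasis rat 8 6
    + (f u v 0 4 + q * f u v 1 5) *: ebasis rat 8 7
    + (f u v 0 5 + f u v 1 4) *: ebasis rat 8 8.
  rewrite alt_ext_inord (@big_cat_nat _ _ _ 2) //= [X in _ + X]big_nat.
  rewrite [X in _ + X]big1 ?addr0; last first.
    by case=> [|[|i]] // _; apply: big1 => j _; apply: scaler0.
  rewrite unlock /= !scaler0 !(addr0, add0r) -/q.
  by apply/rowP => m; rewrite !mxE /f; ring.
have C u v m : (m < 8)%N -> alt_ext (lk_table k) u v 0 (inord m)
    = [:: 0; 0; 0; 0; f u v 0 2 + q * f u v 1 3; f u v 0 3 + f u v 1 2;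
          f u v 0 4 + q * f u v 1 5; f u v 0 5 + f u v 1 4]`_m.
  move=> m8; rewrite E !mxE inordK //.
  by case: m m8 => [|[|[|[|[|[|[|[|m]]]]]]]] // _ /=;
    rewrite ?(mulr0, mulr1, addr0, add0r).
move=> br; rewrite {}/br; apply/rowP => m; rewrite -(inord_val m).
move: (ltn_ord m); move: (m : nat) => {}m m8.
rewrite !mxE !C // /f !C //=.
case: m m8 => [|[|[|[|[|[|[|[|m]]]]]]]] // _ /=;
  rewrite ?(mulr0, mul0r, subr0, sub0r, addr0) /f //; ring.
Qed.

Definition lk (k : int) : Type := 'rV[rat]_8.
HB.instance Definition _ (k : int) := Vector.on (lk k).
HB.instance Definition _ (k : int) := Vector_isLie.Build rat (lk k)
  (alt_ext_linearl (lk_table k)) (alt_ext_linearr (lk_table k))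
  (alt_extxx (lk_table k)) (@lk_jacobi k).

Section RationalForms.
Variables (R : realType) (L : lieAlgType R).
Implicit Types S : set L.

Definition rat_subspace S : Prop :=
  [/\ S 0, (forall u v, S u -> S v -> S (u + v))
    & forall (q : rat) u, S u -> S (ratr q *: u)].

(* The Q-linear span of a finite sequence. *)
Definition rat_span (s : seq L) : set L :=
  [set v | exists c : 'I_(size s) -> rat,
     v = \sum_(i < size s) ratr (c i) *: s`_i].

Definition rat_free (s : seq L) : Prop :=
  forall c : 'I_(size s) -> rat,
    \sum_(i < size s) ratr (c i) *: s`_i = 0 -> forall i, c i = 0.

Definition has_rat_dim S (n : nat) : Prop :=
  exists s : seq L, [/\ size s = n, rat_free s & S = rat_span s].

(* The last condition is the surjectivity of the canonical R-linear map from
   the scalar extension of S to L; both sides having dimension [\dim {:L}] over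
   R, it says that this map is an isomorphism. *)
Definition rational_form S : Prop :=
  [/\ rat_subspace S,
      has_rat_dim S (\dim {:L}),
      (forall u v, S u -> S v -> S (lie u v))
    & forall v : L, exists s : seq L,
        (forall u, u \in s -> S u) /\ v \in <<s>>%VS].

(* [S] (a rational form of [L]) and [M] are isomorphic over Q; the isomorphism
   is given as a map from [M] to [L] with image [S]. *)
Definition rat_lie_isom (M : lieAlgType rat) S : Prop :=
  exists f : M -> L,
    [/\ (forall (q : rat) (u v : M), f (q *: u + v) = ratr q *: f u + f v),
        (forall u v : M, f (lie u v) = lie (f u) (f v)),
        injective f
      & range f = S].

End RationalForms.

Definition square_free (k : nat) : Prop :=
  (0 < k)%N /\ forall p : nat, prime p -> ~~ (p ^ 2 %| k)%N.

(* [X1], ..., [Z4] is a basis of [L] in which [X1, X3] = Z1, [X2, X4] = Z2,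
   [X1, Z1] = Z3, [X2, Z2] = Z4, and every other bracket of two basis elements
   vanishes unless antisymmetry relates it to one of these four. *)
Definition adapted_basis (F : fieldType) (L : lieAlgType F)
    (X1 X2 X3 X4 Z1 Z2 Z3 Z4 : L) : Prop :=
  let b := [:: X1; X2; X3; X4; Z1; Z2; Z3; Z4] in
  [/\ basis_of fullv b,
      [/\ lie X1 X3 = Z1, lie X2 X4 = Z2, lie X1 Z1 = Z3 & lie X2 Z2 = Z4]
    & forall i j : nat, (i < j < 8)%N ->
        (i, j) \notin [:: (0, 2); (1, 3); (0, 4); (1, 5)]%N ->
        lie b`_i b`_j = 0].

Definition form_generators (R : realType) (L : lieAlgType R) (k : nat)
    (X1 X2 X3 X4 Z1 Z2 Z3 Z4 : L) : seq L :=
  let r : R := Num.sqrt k%:R in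
  [:: X1 + X2; r *: (X1 - X2); X3 + X4; r *: (X3 - X4);
      Z1 + Z2; r *: (Z1 - Z2); Z3 + Z4; r *: (Z3 - Z4)].

(* Main.v *)
From HB Require Import structures.
Require Import Defs.
From mathcomp Require Import all_boot all_order all_algebra.
From mathcomp Require Import classical_sets reals.
From mathcomp Require Import ring zify.
Import Order.TTheory GRing.Theory Num.Theory.
Local Open Scope ring_scope.

Set Implicit Arguments.
Unset Strict Implicit.
Unset Printing Implicit Defensive.

(* Write A for the centraliser of [L, L] in L = l4 + l4; A is abelian and L acts
   on it through L / A = R^2, in which the two summands are distinguished.  If S
   is a rational form, rational linear systems that are solvable over R are
   solvable in S, so [ad x1] maps the rational points of A onto those of [L, L]
   for a generic x1 in S.  Relative to [ad x1], a second generic x2 in S acts on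
   the centre by a rational 2 x 2 matrix with one eigenvalue per summand;
   subtracting half the trace times x1 makes the eigenvalues opposite, so that
   their common square is a positive rational, which rescaling turns into a
   square-free integer k.  Together with suitable x3, x4 in A this gives a basis
   of S satisfying the relations of l_k.  Conversely an isomorphism of l_k onto
   S exhibits the eigenvalues +-sqrt k; if S is also isomorphic to l_k', the
   product of sqrt k and sqrt k' is rational, whence k = k'. *)

(** * Bilinear calculus for Lie brackets *)

Section LieBilinear.
Variables (F : fieldType) (L : lieAlgType F).
Implicit Types x y z : L.

HB.instance Definition _ x :=
  GRing.isLinear.Build F L L *:%R (lie x) (lie_linearr x).

Lemma lieDl x y z : lie (x + y) z = lie x z + lie y z.
Proof. by have := lie_linearl z 1 x y; rewrite !scale1r. Qed.

Lemma lieDr x y z : lie z (x + y) = lie z x + lie z y.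
Proof. exact: raddfD. Qed.

Lemma lieC x y : lie x y = - lie y x.
Proof.
have := liexx (x + y); rewrite lieDl !lieDr !liexx add0r addr0.
by move/eqP; rewrite addr_eq0 => /eqP.
Qed.

Lemma lieZr a x y : lie x (a *: y) = a *: lie x y.
Proof. exact: linearZ. Qed.

Lemma lieZl a x y : lie (a *: x) y = a *: lie x y.
Proof. by rewrite lieC lieZr -scalerN -lieC. Qed.

Lemma lieBr x y z : lie z (x - y) = lie z x - lie z y.
Proof. exact: raddfB. Qed.

Lemma lie_sum (I J : finType) (a : I -> F) (b : J -> F) (x : I -> L)
    (y : J -> L) :
  lie (\sum_i a i *: x i) (\sum_j b j *: y j) =
  \sum_i \sum_j (a i * b j) *: lie (x i) (y j).
Proof.
rewrite lieC linear_sum -sumrN; apply: eq_bigr => i _ /=.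
rewrite -lieC lieZl linear_sum scaler_sumr; apply: eq_bigr => j _ /=.
by rewrite lieZr scalerA.
Qed.

End LieBilinear.

(** Swapping the summation indices in one half of [alt_ext] moves the antisymmetrisation from the
    coefficients to the table, so that the sum matches [lie_sum] term by term. *)
Lemma alt_ext_table (F : fieldType) n (c : nat -> nat -> 'rV[F]_n)
    (u v : 'rV[F]_n) :
  alt_ext c u v =
  \sum_i \sum_j (u 0 i * v 0 j) *: (c i.+1 j.+1 - c j.+1 i.+1).
Proof.
rewrite /alt_ext.
under eq_bigr => i _ do under eq_bigr => j _ do rewrite scalerBl.
under [RHS]eq_bigr => i _ do under eq_bigr => j _ do rewrite scalerBr.
under eq_bigr => i _ do rewrite sumrB.
under [RHS]eq_bigr => i _ do rewrite sumrB.
rewrite !sumrB; congr (_ - _); rewrite exchange_big.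
by apply: eq_bigr => i _; apply: eq_bigr => j _; rewrite mulrC.
Qed.

(** * Rational-linear maps into a real vector space *)

Section Semilinear.
Variables (R : realType) (V : lmodType rat) (W : lmodType R) (f : V -> W).
Hypothesis f_lin : forall q u v, f (q *: u + v) = ratr q *: f u + f v.

Lemma semilinear0 : f 0 = 0.
Proof.
by have := f_lin (-1) 0 0; rewrite scaler0 addr0 rmorphN1 scaleN1r addNr.
Qed.

Lemma semilinearZ q u : f (q *: u) = ratr q *: f u.
Proof. by rewrite -[q *: u]addr0 f_lin semilinear0 addr0. Qed.

Lemma semilinearB u v : f (u - v) = f u - f v.
Proof. by rewrite addrC -scaleN1r f_lin rmorphN1 scaleN1r addrC. Qed.

Lemma semilinear_sum (I : finType) (q : I -> rat) (u : I -> V) :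
  f (\sum_i q i *: u i) = \sum_i ratr (q i) *: f (u i).
Proof.
apply: (big_ind2 (fun u v => f u = v)) => [|x ? y ? <- <-|i _].
- exact: semilinear0.
- by rewrite -{1}[x]scale1r f_lin rmorph1 scale1r.
- exact: semilinearZ.
Qed.

End Semilinear.

(** * Rational spans, and bases with the relations of [lk k] *)

Section Span.
Variables (R : realType) (L : lieAlgType R).
Implicit Types (s : seq L) (S : set L).

(* The indices are one less than in [lk_table k]. *)
Definition lk_relations (k : nat) s : Prop :=
  [/\ [/\ lie s`_0 s`_2 = s`_4, lie s`_0 s`_3 = s`_5, lie s`_1 s`_2 = s`_5
        & lie s`_1 s`_3 = k%:R *: s`_4],
      [/\ lie s`_0 s`_4 = s`_6, lie s`_0 s`_5 = s`_7, lie s`_1 s`_4 = s`_7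
        & lie s`_1 s`_5 = k%:R *: s`_6]
    & forall i j : nat, (i < j < 8)%N ->
        ~~ ((i < 2) && (1 < j < 6))%N -> lie s`_i s`_j = 0].

(** The coefficients form a row vector because that is the carrier of [lk k]: for eight generators
    this map itself serves as the isomorphism. *)
Definition comb s (v : 'rV[rat]_(size s)) : L :=
  \sum_(i < size s) ratr (v 0 i) *: s`_i.

Lemma comb_linear s (q : rat) u v :
  @comb s (q *: u + v) = ratr q *: comb u + comb v.
Proof.
rewrite /comb scaler_sumr -big_split; apply: eq_bigr => i _ /=.
by rewrite !mxE rmorphD rmorphM scalerDl scalerA.
Qed.

Lemma comb_spanE s v : rat_span s v <-> exists c, v = @comb s c.
Proof.
split=> [[c ->]|[c ->]]; last by exists (c 0).
by exists (\row_i c i); apply: eq_bigr => i _; rewrite mxE.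
Qed.

Lemma rat_subspace_span s : rat_subspace (rat_span s).
Proof.
split=> [|u v /comb_spanE[c ->] /comb_spanE[d ->]|q u /comb_spanE[c ->]].
- apply/comb_spanE; exists 0; rewrite /comb big1 // => i _.
  by rewrite mxE rmorph0 scale0r.
- apply/comb_spanE; exists (1 *: c + d).
  by rewrite comb_linear rmorph1 scale1r.
- apply/comb_spanE; exists (q *: c + 0); rewrite comb_linear.
  rewrite [comb 0](_ : _ = 0) ?addr0 // /comb big1 // => i _.
  by rewrite mxE rmorph0 scale0r.
Qed.

Lemma rat_subspace_sum S (I : finType) (q : I -> rat) (v : I -> L) :
  rat_subspace S -> (forall i, S (v i)) -> S (\sum_i ratr (q i) *: v i).
Proof.
by case=> S0 SD SZ Sv; apply: (big_ind S) => // i _; apply: SZ.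
Qed.

Lemma mem_rat_span s i : (i < size s)%N -> rat_span s s`_i.
Proof.
move=> si; exists (fun j => (j == Ordinal si)%:R).
rewrite (bigD1 (Ordinal si)) //= eqxx rmorph1 scale1r big1 ?addr0 // => j.
by move=> /negPf ->; rewrite rmorph0 scale0r.
Qed.

Lemma free_sum0 s (a : 'I_(size s) -> R) :
  free s -> \sum_(i < size s) a i *: s`_i = 0 -> forall i, a i = 0.
Proof.
by rewrite -[free s]/(free (in_tuple s)) => /freeP fs; exact: fs.
Qed.

Lemma comb_inj s : free s -> injective (@comb s).
Proof.
move=> fs u v /eqP; rewrite -subr_eq0 => /eqP e; apply/rowP => i.
apply/eqP; rewrite -subr_eq0; apply/eqP.
apply: (@fmorph_inj _ _ (@ratr R)); rewrite rmorph0.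
move: i; apply: free_sum0 => //; rewrite -[RHS]e -sumrB.
by apply: eq_bigr => i _; rewrite rmorphB scalerBl.
Qed.

Lemma rat_free_free s : free s -> rat_free s.
Proof.
move=> fs c e i; apply: (@fmorph_inj _ _ (@ratr R)); rewrite rmorph0.
by move: i; apply: free_sum0.
Qed.

Lemma lk_table0 k (i j : nat) :
  ~~ ((0 < i < 3) && (2 < j < 7))%N -> lk_table k i j = 0.
Proof.
by case: i => [|[|[|i]]] //; case: j => [|[|[|[|[|[|[|j]]]]]]].
Qed.

(** The relations say that [comb s] carries the structure constants of [lk k] to the brackets of
    [s]; it is injective because [s] is free already over [R]. *)
Lemma rat_form_of_lk_relations (k : nat) s :
  basis_of fullv s -> size s = 8 -> lk_relations k s ->
  rational_form (rat_span s) /\ rat_lie_isom (lk k%:Z) (rat_span s).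
Proof.
case: s => [|s0 [|s1 [|s2 [|s3 [|s4 [|s5 [|s6 [|s7 [|? ?]]]]]]]]] //.
set s := [:: s0; s1; s2; s3; s4; s5; s6; s7] => bs s8.
move=> [[h02 h03 h12 h13] [h04 h05 h14 h15] h0].
have fs := basis_free bs.
pose f : lk k%:Z -> L := @comb s.
have f_lin (q : rat) (u v : lk k%:Z) : f (q *: u + v) = ratr q *: f u + f v.
  exact: comb_linear.
have f0 := semilinear0 f_lin; have fZ := semilinearZ f_lin.
have fB := semilinearB f_lin.
have fe m : (m < 8)%N -> f (ebasis rat 8 m.+1) = s`_m.
  move=> m8; rewrite /f /comb (bigD1 (Ordinal m8)) //= mxE eqxx rmorph1 scale1r.
  rewrite big1 ?addr0 // => i ni; rewrite mxE.
  by rewrite [_ == _](negPf ni) rmorph0 scale0r.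
have tab i j : (i < j < 8)%N -> f (lk_table k i.+1 j.+1) = lie s`_i s`_j.
  case: (boolP ((i < 2) && (1 < j < 6))%N) => [|nz ij]; last first.
    by rewrite h0 // lk_table0.
  case: i => [|[|i]] //; case: j => [|[|[|[|[|[|j]]]]]] //= _ _;
    rewrite ?[f (_ *: _)]fZ fe // ?ratr_int.
  - by rewrite -[LHS]h13.
  - by rewrite -[LHS]h15.
(* On and below the diagonal the table is zero, so at most one term of the antisymmetrised table
   survives. *)
have tab0 i j : (j <= i)%N -> lk_table k i.+1 j.+1 = 0.
  by move=> ji; apply: lk_table0; lia.
have tabs i j : (i < 8)%N -> (j < 8)%N ->
    f (lk_table k i.+1 j.+1 - lk_table k j.+1 i.+1) = lie s`_i s`_j.
  move=> i8 j8; rewrite fB; case: (ltngtP i j) => ij.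
  - by rewrite tab ?ij // tab0 1?ltnW // f0 subr0.
  - by rewrite [in X in _ - X]tab ?ij // tab0 1?ltnW // f0 sub0r -lieC.
  - by rewrite ij subrr liexx.
have f_lie (u v : lk k%:Z) : f (lie u v) = lie (f u) (f v).
  rewrite {2 3}/f /comb lie_sum [lie u v]alt_ext_table.
  (* Unit coefficients are inserted so that [semilinear_sum] applies to the outer sum. *)
  rewrite -[X in f X](eq_bigr _ (fun i _ => scale1r _)).
  rewrite (semilinear_sum f_lin).
  apply: eq_bigr => i _; rewrite rmorph1 scale1r (semilinear_sum f_lin).
  by apply: eq_bigr => j _; rewrite rmorphM tabs ?ltn_ord.
split; first split.
- exact: rat_subspace_span.
- exists s; split=> //; last exact: rat_free_free.
  by move: fs; rewrite /free (eqP (proj1 (andP bs))) => /eqP ->.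
- move=> u v /comb_spanE[u' ->] /comb_spanE[v' ->]; apply/comb_spanE.
  by exists (@lie _ (lk k%:Z) u' v'); exact: esym (f_lie u' v').
- move=> v; exists s; split; last by rewrite (eqP (proj1 (andP bs))) memvf.
  by move=> u us; rewrite -(nth_index 0 us); apply: mem_rat_span;
    rewrite index_mem.
- exists f; split=> //; first exact: (comb_inj fs).
  apply/seteqP; split=> v.
    by case=> u _ <-; apply/comb_spanE; exists u.
  by move/comb_spanE => [u ->]; exists u.
Qed.

End Span.

(** * Descent of linear algebra from the reals to the rationals *)

Section Descent.
Variables (R : realType) (L : lieAlgType R) (S : set L).
Hypothesis formS : rational_form S.

(** By the last clause of [rational_form] a rational basis of [S] spans [L] over [R], and its size
    is the real dimension. *)
Lemma rational_form_basis :
  exists s : seq L, [/\ basis_of fullv s, size s = \dim {:L} & S = rat_span s].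
Proof.
case: formS => [_ [s [ss fs Ss]] _ gen]; exists s; split=> //.
rewrite basisEdim ss leqnn andbT; apply/subvP => v _.
have [t [tS]] := gen v; apply: subvP; apply/span_subvP => u /tS.
rewrite Ss => -[c ->]; apply: memv_suml => i _; apply: memvZ.
by apply: memv_span; rewrite mem_nth.
Qed.

(* Inclusions of row spaces are reflected by extension of scalars. *)
Lemma rational_solution n (u v : 'I_n -> L) (a b : L) (r : 'I_n -> R) :
  (forall i, S (u i)) -> (forall i, S (v i)) -> S a -> S b ->
  \sum_i r i *: u i = a -> \sum_i r i *: v i = b ->
  exists q : 'I_n -> rat,
    \sum_i ratr (q i) *: u i = a /\ \sum_i ratr (q i) *: v i = b.
Proof.
have [s [bs ss ->]] := rational_form_basis.
have fs := basis_free bs.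
move=> Su Sv /comb_spanE[ca ->] /comb_spanE[cb ->].
have [cu cuE] := fin_all_exists (fun i => (comb_spanE _ _).1 (Su i)).
have [cv cvE] := fin_all_exists (fun i => (comb_spanE _ _).1 (Sv i)).
pose rm (c : 'I_n -> 'rV[rat]_(size s)) := \matrix_(i < n) c i.
have combE (x : 'I_n -> R) c w d : (forall i, w i = comb (c i)) ->
    \sum_i x i *: w i = @comb _ _ s d <->
    (\row_i x i) *m map_mx (@ratr R) (rm c) = map_mx (@ratr R) d.
  move=> wE.
  have -> : \sum_i x i *: w i =
      \sum_j ((\row_i x i) *m map_mx (@ratr R) (rm c)) 0 j *: s`_j.
    under eq_bigr => i _ do rewrite wE scaler_sumr.
    rewrite exchange_big; apply: eq_bigr => j _ /=.
    rewrite !mxE scaler_suml; apply: eq_bigr => i _.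
    by rewrite !mxE scalerA.
  split=> [e|->]; last by apply: eq_bigr => j _; rewrite !mxE.
  apply/rowP => j; apply/eqP; rewrite -subr_eq0; apply/eqP; move: j.
  apply: free_sum0 fs _; rewrite -[RHS](subrr (comb d)) -{1}e -sumrB.
  by apply: eq_bigr => j _; rewrite scalerBl [map_mx _ d 0 j]mxE.
move=> /(combE _ _ _ _ cuE) eu /(combE _ _ _ _ cvE) ev.
(* The two equations share the unknown row, so they form one row-space inclusion of concatenated
   matrices, which [r] witnesses over [R]. *)
have /submxP[q qE] : (row_mx ca cb <= row_mx (rm cu) (rm cv))%MS.
  rewrite -(map_submx (@ratr R)) !map_row_mx.
  by apply/submxP; exists (\row_i r i); rewrite mul_mx_row eu ev.
move: qE; rewrite mul_mx_row => /eq_row_mx[qa qb].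
exists (q 0); split.
  apply/(combE _ _ _ _ cuE); rewrite [ca in RHS]qa map_mxM; congr (_ *m _).
  by apply/rowP => i; rewrite !mxE.
apply/(combE _ _ _ _ cvE); rewrite [cb in RHS]qb map_mxM; congr (_ *m _).
by apply/rowP => i; rewrite !mxE.
Qed.

(** Along a rational basis the two equations become a linear system with data in [S], which the
    coordinates of [y] solve over [R]. *)
Lemma rational_preimage (phi psi : {linear L -> L}) (y a b : L) :
  (forall x, S x -> S (phi x)) -> (forall x, S x -> S (psi x)) ->
  S a -> S b -> phi y = a -> psi y = b ->
  exists x, [/\ S x, phi x = a & psi x = b].
Proof.
move=> Sphi Spsi Sa Sb ya yb.
have [s [bs ss SE]] := rational_form_basis.
have Ss (i : 'I_(size s)) : S s`_i by rewrite SE; apply: mem_rat_span.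
have yE : y = \sum_(i < size s) coord (in_tuple s) i y *: s`_i.
  by apply: coord_basis (memvf _); exact: bs.
have [q [qa qb]] : exists q : 'I_(size s) -> rat,
   \sum_i ratr (q i) *: phi s`_i = a /\ \sum_i ratr (q i) *: psi s`_i = b.
  apply: (rational_solution (r := fun i => coord (in_tuple s) i y)) => //.
  - by move=> i; apply: Sphi.
  - by move=> i; apply: Spsi.
  - by rewrite -ya [in RHS]yE linear_sum; apply: eq_bigr => i _;
      rewrite linearZ.
  - by rewrite -yb [in RHS]yE linear_sum; apply: eq_bigr => i _;
      rewrite linearZ.
exists (\sum_i ratr (q i) *: s`_i); split.
- by apply: rat_subspace_sum => //; case: formS.
- by rewrite -qa linear_sum; apply: eq_bigr => i _; rewrite linearZ.
- by rewrite -qb linear_sum; apply: eq_bigr => i _; rewrite linearZ.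
Qed.

(** The real coordinates of a member of [S] solve a system with data in [S], so rational
    coefficients exist as well. *)
Lemma rat_span_basis (s : seq L) :
  basis_of fullv s -> (forall i : 'I_(size s), S s`_i) -> S = rat_span s.
Proof.
move=> bs Ss; have subS : rat_subspace S by case: formS.
apply/seteqP; split=> [v Sv|v [c ->]]; last exact: rat_subspace_sum.
have S0 : S 0 by case: subS.
(* Only one equation matters here; the second system is the trivial one. *)
have [q [qv _]] : exists q : 'I_(size s) -> rat,
    \sum_i ratr (q i) *: s`_i = v /\ \sum_i ratr (q i) *: (0 : L) = 0.
  apply: (rational_solution (r := fun i => coord (in_tuple s) i v)) => //.
    by apply: esym; apply: (coord_basis (X := in_tuple s)) (memvf v); exact: bs.
  by rewrite big1 // => i _; rewrite scaler0.
by exists q.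
Qed.

(* A vector space is not the union of two hyperplanes. *)
Lemma rational_generic (alpha beta : {scalar L}) :
  (exists v, alpha v != 0) -> (exists v, beta v != 0) ->
  exists v, [/\ S v, alpha v != 0 & beta v != 0].
Proof.
have [_ SD _] : rat_subspace S by case: formS.
(* A form vanishing on [S] would vanish on its real span, which is all of [L]. *)
have pick (gamma : {scalar L}) : (exists v, gamma v != 0) ->
    exists2 v, S v & gamma v != 0.
  case=> v; case: formS => _ _ _ /(_ v)[s [sS vs]] gv.
  have [/hasP[u us gu]|/hasPn g0] := boolP (has (fun u => gamma u != 0) s).
    by exists u => //; apply: sS.
  case/negP: gv; rewrite (coord_span (X := in_tuple s) vs) linear_sum big1 // =>
    i _.
  rewrite linearZ /= (eqP (negbNE (g0 _ _))) ?mulr0 //.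
  exact: mem_nth.
move=> /pick[u Su au] /pick[v Sv bv].
have [bu0|bu] := eqVneq (beta u) 0; last by exists u.
have [av0|av] := eqVneq (alpha v) 0; last by exists v.
(* Here each of [u] and [v] is killed by exactly one of the two forms. *)
by exists (u + v); rewrite !linearD /= bu0 av0 add0r addr0; split=> //;
  apply: SD.
Qed.

End Descent.

(** * Coordinates on [l4 + l4] *)

Section Coordinates.
Variable F : fieldType.
Local Notation L := (l4 F * l4 F)%type.
Implicit Types (u v : L) (b : bool) (m : nat).

(* The coordinate on [Y_(m+1)] of the summand selected by [b]. *)
Definition coor b m u : F := (if b then u.2 else u.1 : 'rV[F]_4) 0 (inord m).

Lemma coor_linear b m : scalar (coor b m).
Proof. by move=> a u v; rewrite /coor; case: b; rewrite !mxE. Qed.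

HB.instance Definition _ b m :=
  GRing.isLinear.Build F L F *%R (coor b m) (coor_linear b m).

Lemma coor_lie b m u v : (m < 4)%N ->
  coor b m (lie u v) =
  [:: 0; 0; coor b 0 u * coor b 1 v - coor b 1 u * coor b 0 v;
      coor b 0 u * coor b 2 v - coor b 2 u * coor b 0 v]`_m.
Proof.
have E (x y : 'rV[F]_4) : (m < 4)%N ->
   alt_ext (l4_table F) x y 0 (inord m) =
   [:: 0; 0; x 0 (inord 0) * y 0 (inord 1) - x 0 (inord 1) * y 0 (inord 0);
      x 0 (inord 0) * y 0 (inord 2) - x 0 (inord 2) * y 0 (inord 0)]`_m.
  move=> m4; rewrite alt_ext_inord unlock /= !scaler0 !(addr0,
    add0r) !mxE inordK //.
  by case: m m4 => [|[|[|[|m]]]] // _ /=; rewrite ?(mulr0, mulr1, addr0, add0r).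
by move=> m4; case: b; apply: E.
Qed.

Definition coor_lie0 b u v : coor b 0 (lie u v) = 0 :=
  @coor_lie b 0 u v isT.
Definition coor_lie1 b u v : coor b 1 (lie u v) = 0 :=
  @coor_lie b 1 u v isT.
Definition coor_lie2 b u v :
    coor b 2 (lie u v) =
    coor b 0 u * coor b 1 v - coor b 1 u * coor b 0 v :=
  @coor_lie b 2 u v isT.
Definition coor_lie3 b u v :
    coor b 3 (lie u v) =
    coor b 0 u * coor b 2 v - coor b 2 u * coor b 0 v :=
  @coor_lie b 3 u v isT.
Definition coor_lieE := (coor_lie0, coor_lie1, coor_lie2, coor_lie3).

Lemma coor_ext u v :
  (forall b m, (m < 4)%N -> coor b m u = coor b m v) -> u = v.
Proof.
case: u v => [u1 u2] [v1 v2] e.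
congr pair; apply/rowP => i; rewrite -(inord_val i).
  exact: (e false i (ltn_ord i)).
exact: (e true i (ltn_ord i)).
Qed.

Definition of_coor (f : bool -> nat -> F) : L :=
  (\row_(i < 4) f false i, \row_(i < 4) f true i).

Lemma of_coorK f b m : (m < 4)%N -> coor b m (of_coor f) = f b m.
Proof. by move=> m4; rewrite /coor; case: b; rewrite mxE inordK. Qed.

Lemma dim_l4l4 : \dim {:L} = 8.
Proof. by rewrite dimvf. Qed.

Lemma basis_l4l4 (s : seq L) : size s = 8 ->
  (forall k : 'I_(size s) -> F,
    (forall b m, (m < 4)%N -> \sum_i k i * coor b m s`_i = 0) ->
    forall i, k i = 0) ->
  basis_of fullv s.
Proof.
move=> s8 fs; rewrite basisEfree subvf dim_l4l4 s8 leqnn !andbT.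
rewrite -[free s]/(free (in_tuple s)); apply/freeP => k e; apply: fs => b m m4.
transitivity (coor b m (\sum_i k i *: s`_i));
  last by rewrite [X in coor _ _ X]e linear0.
by rewrite linear_sum; apply: eq_bigr => i _; rewrite linearZ.
Qed.

End Coordinates.

(** * Recognising a basis with the relations of [lk k] *)

Lemma line_through_eq0 (F : fieldType) (c mu : bool -> F) (x y : F) :
  mu false != mu true -> (forall b, c b != 0) ->
  (forall b, c b * (x + mu b * y) = 0) -> x = 0 /\ y = 0.
Proof.
move=> nmu nc e.
have {}e (b : bool) : x + mu b * y = 0.
  by apply/eqP; move/eqP: (e b); rewrite mulf_eq0 (negPf (nc b)).
have y0 : y = 0.
  apply/eqP; have /eqP : (mu false - mu true) * y = 0.
    by rewrite -[RHS](subrr 0) -{1}(e false) -(e true); ring.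
  by rewrite mulf_eq0 subr_eq0 (negPf nmu).
by split=> //; move: (e false); rewrite y0 mulr0 addr0.
Qed.

Section Existence.
Variable R : realType.
Local Notation L := (l4 R * l4 R)%type.

(** On elements with zero coordinate 0, [x2] acts on summand [b] as [mu b] times [x1], and
    [mu b ^+ 2 = k] yields the relations containing [k]. Independence is triangular: coordinates 0
    to 3 isolate the successive pairs of [s], each time leaving an affine function with the two
    distinct zeros [mu false] and [mu true]. *)
Lemma lk_relations_coor (k : nat) (mu : bool -> R) (x1 x2 x3 x4 : L) :
  mu false != mu true -> (forall b, mu b ^+ 2 = k%:R) ->
  (forall b, [/\ coor b 0 x1 != 0, coor b 0 x2 = mu b * coor b 0 x1,
     coor b 0 x3 = 0, coor b 1 x3 != 0 & coor b 0 x4 = 0]) ->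
  lie x1 x2 = 0 -> lie x1 x4 = lie x2 x3 ->
  let z1 := lie x1 x3 in let z2 := lie x1 x4 in
  let s := [:: x1; x2; x3; x4; z1; z2; lie x1 z1; lie x1 z2] in
  basis_of fullv s /\ lk_relations k s.
Proof.
move=> nmu sl H e12 e14 z1 z2 s.
have a0 b : coor b 0 x1 != 0 by case: (H b).
have E2 b : coor b 0 x2 = mu b * coor b 0 x1 by case: (H b).
have E3 b : coor b 0 x3 = 0 by case: (H b).
have c0 b : coor b 1 x3 != 0 by case: (H b).
have E4 b : coor b 0 x4 = 0 by case: (H b).
(* Coordinates 2 and 3 of [e14] determine coordinates 1 and 2 of [x4]. *)
have E41 b : coor b 1 x4 = mu b * coor b 1 x3.
  have := congr1 (coor b 2) e14; rewrite !coor_lieE /= E2 E3 E4 !mulr0 !subr0.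
  by move=> e; apply: (mulfI (a0 b)); rewrite e; ring.
have E42 b : coor b 2 x4 = mu b * coor b 2 x3.
  have := congr1 (coor b 3) e14; rewrite !coor_lieE /= E2 E3 E4 !mulr0 !subr0.
  by move=> e; apply: (mulfI (a0 b)); rewrite e; ring.
pose E := (coor_lieE, E2, E3, E4, E41, E42, subr0, mul0r, mulr0, subrr).
split.
  apply: basis_l4l4 => // c.
  pose d i := c (inord i).
  have cE i : c i = d i by rewrite /d inord_val.
  move=> e0; have {e0}e b m : (m < 4)%N ->
      d 0%N * coor b m x1 + (d 1%N * coor b m x2 + (d 2%N * coor b m x3 +
      (d 3%N * coor b m x4 + (d 4%N * coor b m z1 + (d 5%N * coor b m z2 +
      (d 6%N * coor b m (lie x1 z1) + d 7%N * coor b m (lie x1 z2))))))) = 0.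
    move=> m4; rewrite -[RHS](e0 b m m4) (eq_bigr (fun i : 'I_8 =>
      d i * coor b m s`_i)); last first.
      by move=> i _; rewrite cE.
    by rewrite -(big_mkord xpredT (fun i =>
      d i * coor b m s`_i)) unlock /= addr0.
  have ac0 b : coor b 0 x1 * coor b 1 x3 != 0 by rewrite mulf_neq0.
  have aac0 b : coor b 0 x1 * (coor b 0 x1 * coor b 1 x3) != 0
    by rewrite mulf_neq0.
  have [d0 d1] : d 0%N = 0 /\ d 1%N = 0.
    apply: (line_through_eq0 nmu a0) => b.
    by rewrite -[RHS](e b 0) // !E !addr0; ring.
  have [d2 d3] : d 2%N = 0 /\ d 3%N = 0.
    apply: (line_through_eq0 nmu c0) => b.
    by rewrite -[RHS](e b 1) // d0 d1 !E !addr0; ring.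
  have [d4 d5] : d 4%N = 0 /\ d 5%N = 0.
    apply: (line_through_eq0 nmu ac0) => b.
    by rewrite -[RHS](e b 2) // d0 d1 d2 d3 !E !addr0; ring.
  have [d6 d7] : d 6%N = 0 /\ d 7%N = 0.
    apply: (line_through_eq0 nmu aac0) => b.
    by rewrite -[RHS](e b 3) // d0 d1 d2 d3 d4 d5 !E; ring.
  by move=> i; rewrite cE; case: i => [[|[|[|[|[|[|[|[|i]]]]]]]] i8] /=.
(* From [x3] on, all members have zero coordinate 0 and hence commute with one another. *)
have A0 b l : (1 < l < 8)%N -> coor b 0 s`_l = 0.
  by case: l => [|[|[|[|[|[|[|[|l]]]]]]]] //= _; rewrite ?E.
have ab (i j : nat) : (1 < i < 8)%N -> (1 < j < 8)%N -> lie s`_i s`_j = 0.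
  move=> i8 j8; apply: coor_ext => b m m4; rewrite linear0 coor_lie // !A0 //.
  by case: m m4 => [|[|[|[|m]]]] //= _; rewrite ?(mul0r, mulr0, subrr).
split.
- split=> //=; apply: coor_ext => b m m4; rewrite linearZ /= !coor_lie //.
  case: m m4 => [|[|[|[|m]]]] //= _; rewrite !E ?mulr0 //; rewrite -(sl b);
    ring.
- split=> //=; apply: coor_ext => b m m4; rewrite ?linearZ /= !coor_lie //;
  case: m m4 => [|[|[|[|m]]]] //= _; rewrite !E ?mulr0 //; rewrite -?(sl b);
    ring.
- move=> i j; case: i => [|[|i]] ij; last by move=> _; apply: ab; lia.
    case: j ij => [|[|[|[|[|[|[|[|j]]]]]]]] //= _ _;
      by apply: coor_ext => b m m4; rewrite linear0 coor_lie //;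
        case: m m4 => [|[|[|[|m]]]] //= _; rewrite !E.
  case: j ij => [|[|[|[|[|[|[|[|j]]]]]]]] //= _ _;
    by apply: coor_ext => b m m4; rewrite linear0 coor_lie //;
      case: m m4 => [|[|[|[|m]]]] //= _; rewrite !E.
Qed.
End Existence.

(** * Square-free parts of integers and rationals *)

Lemma square_free_part (n : nat) : (0 < n)%N ->
  exists k m : nat, [/\ square_free k, (0 < m)%N & n = (m ^ 2 * k)%N].
Proof.
move=> n0.
have ex1 : exists m, (0 < m)%N && (m ^ 2 %| n)%N by exists 1%N;
  rewrite exp1n dvd1n.
have bnd m : (0 < m)%N && (m ^ 2 %| n)%N -> (m <= n)%N.
  case/andP=> m0 /(dvdn_leq n0); apply: leq_trans.
  by rewrite -[X in (X <= _)%N]expn1 leq_pexp2l.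
(* With [m] maximal, a prime square dividing the cofactor [k] would give a larger [m]. *)
case: (ex_maxnP ex1 bnd) => m /andP[m0 /dvdnP[k kE]] mmax.
exists k, m; split=> //; last by rewrite mulnC.
split=> [|p pp]; first by case: k kE n0 => // ->.
apply/negP => pk; have := mmax (m * p)%N.
rewrite muln_gt0 m0 prime_gt0 //= kE expnMn mulnC dvdn_mul //.
by move=> /(_ isT); rewrite leqNgt ltn_Pmulr // prime_gt1.
Qed.

(** A fraction is the product of its numerator and denominator divided by the square of the
    denominator, so the square-free part of that product serves. *)
Lemma rat_square_free_part (q : rat) : 0 < q ->
  exists (k : nat) (m : rat), [/\ square_free k, m != 0 & q = m ^+ 2 * k%:R].
Proof.
move=> q0; have n0 : (0 < `|numq q| * `|denq q|)%N.
  by rewrite muln_gt0 !absz_gt0 denq_neq0 numq_eq0 gt_eqF.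
have [k [m [sk m0 e]]] := square_free_part n0.
exists k, (m%:R / (denq q)%:~R); split=> //.
  by rewrite mulf_neq0 ?invr_eq0 ?intr_eq0 ?denq_neq0 // pnatr_eq0 -lt0n.
have d0 : (denq q)%:~R != 0 :> rat by rewrite intr_eq0 denq_neq0.
have : (numq q * denq q)%:~R = (m%:R ^+ 2 * k%:R : rat).
  rewrite -natrX -natrM -e -[numq q]gez0_abs ?numq_ge0 ?ltW //.
  by rewrite -{1}[denq q]gez0_abs // -PoszM.
rewrite intrM => e2; rewrite -{1}[q]divq_num_den expr_div_n.
apply: (mulIf d0); apply: (mulIf d0).
rewrite mulrVK ?unitfE // e2; field.
exact: d0.
Qed.

(** At each prime the valuations of [k] and [k'] are at most 1 and have an even sum, so they
    agree. *)
Lemma square_free_mul_square (k k' : nat) (q : rat) :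
  square_free k -> square_free k' -> k%:R * k'%:R = q ^+ 2 -> k = k'.
Proof.
move=> [k0 sk] [k'0 sk'] e.
have d0 : (denq q)%:~R != 0 :> rat by rewrite intr_eq0 denq_neq0.
have {}e : (k * k' * `|denq q| ^ 2 = `|numq q| ^ 2)%N.
  apply: (@mulrIn rat 1); first exact: oner_neq0.
  rewrite natrM !natrX natrM e !natr_absz !intr_norm !real_normK ?num_real //.
  by rewrite -{1}[q]divq_num_den expr_div_n mulrVK // unitfE expf_neq0.
have n0 : (0 < `|numq q|)%N.
  have : (0 < k * k' * `|denq q| ^ 2)%N.
    by rewrite !muln_gt0 k0 k'0 absz_gt0 denq_neq0.
  by rewrite e expn_gt0 orbF.
have dn0 : (0 < `|denq q|)%N by rewrite absz_gt0 denq_neq0.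
have logn1 p (n : nat) : (0 < n)%N -> (forall p,
  prime p -> ~~ (p ^ 2 %| n)%N) ->
    (logn p n <= 1)%N.
  move=> n1 sn; case pp: (prime p); last by rewrite lognE pp.
  by rewrite leqNgt -pfactor_dvdn // sn.
apply: eqn_from_log => // p.
have := congr1 (logn p) e.
rewrite !lognM ?muln_gt0 ?k0 ?k'0 ?n0 ?dn0 //.
have := logn1 p k k0 sk; have := logn1 p k' k'0 sk'; lia.
Qed.

(** * Every rational form is isomorphic to some [lk k] *)

Section Forms.
Variables (R : realType).
Local Notation L := (l4 R * l4 R)%type.
Variable S : set L.
Hypothesis formS : rational_form S.

(** Up to sign, the determinant of the classes of [x] and [v] in L / A = R^2. *)
Definition coor_det (x v : L) : R :=
  coor true 0 x * coor false 0 v - coor false 0 x * coor true 0 v.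

Lemma coor_det_linear x : scalar (coor_det x).
Proof. by move=> a u v; rewrite /coor_det !linearP /=; ring. Qed.

HB.instance Definition _ x :=
  GRing.isLinear.Build R L R *%R (coor_det x) (coor_det_linear x).

(* Since [g] is generic in [[L, L]], the equation [lie g y = 0] cuts out the
   centraliser of [[L, L]]. *)
Lemma rational_ad_preimage (x1 g w : L) :
  S x1 -> S g -> (forall b, coor b 0 x1 != 0) ->
  (forall b, [/\ coor b 0 g = 0, coor b 1 g = 0 & coor b 2 g != 0]) ->
  S w -> (forall b, coor b 0 w = 0 /\ coor b 1 w = 0) ->
  exists y, [/\ S y, lie x1 y = w & forall b, coor b 0 y = 0].
Proof.
move=> S1 Sg a0 gE Sw wE; case: (formS) => subS _ Slie _.
have S0 : S 0 by case: subS.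
(* On A, [ad x1] moves coordinates 1 and 2 to 2 and 3, scaling them by [coor b 0 x1]; division gives
   a real preimage. *)
pose y := of_coor (fun b m =>
  [:: 0; coor b 2 w / coor b 0 x1; coor b 3 w / coor b 0 x1; 0]`_m).
have e1 : lie x1 y = w.
  apply: coor_ext => b m m4; rewrite coor_lie // !of_coorK //= !mulr0 !subr0.
  by case: m m4 => [|[|[|[|m]]]] // _ /=; case: (wE b) => // _ _;
    rewrite mulrC mulfVK.
have e2 : lie g y = 0.
  apply: coor_ext => b m m4; rewrite coor_lie // !of_coorK //= linear0.
  have [-> -> _] := gE b; rewrite !mul0r !mulr0 subr0.
  by case: m m4 => [|[|[|[|m]]]].
have [x [Sx x1E gx]] := rational_preimage formS (phi := lie x1) (psi := lie g)
  (fun v => Slie _ v S1) (fun v => Slie _ v Sg) Sw S0 e1 e2.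
(* Up to sign, coordinate 3 of [lie g x] is the nonzero [coor b 2 g] times [coor b 0 x]. *)
exists x; split=> // b; have := congr1 (coor b 3) gx.
have [g0 _ g2] := gE b.
rewrite coor_lie3 linear0 g0 mul0r sub0r => /eqP.
by rewrite oppr_eq0 mulf_eq0 (negPf g2) => /eqP.
Qed.

Lemma rational_form_isom : exists k, square_free k /\ rat_lie_isom (lk k%:Z) S.
Proof.
case: (formS) => [[S0 SD SZ] _ Slie _].
have SB u v : S u -> S v -> S (u - v).
  by move=> Su Sv; apply: SD => //; rewrite -scaleN1r -(rmorphN1 (@ratr R));
    apply: SZ.
have [x1 [S1 a1 a2]] : exists x,
    [/\ S x, coor false 0 x != 0 & coor true 0 x != 0].
  by apply: (rational_generic (alpha := coor false 0) (beta := coor true 0)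
    formS);
    exists (of_coor (fun _ _ => 1));
    rewrite /= of_coorK ?oner_neq0.
have {a1 a2}a0 b : coor b 0 x1 != 0 by case: b.
(* A vector on which both forms are nonzero gives a [g] generic in [L, L], as [rational_ad_preimage]
   requires. *)
pose phi b : {scalar L} := coor b 2 \o lie x1.
have phi0 b : exists v, phi b v != 0.
  exists (of_coor (fun _ m => (m == 1%N)%:R)).
  by rewrite /= coor_lie2 !of_coorK //= mulr1 mulr0 subr0.
have [h [Sh g1 g2]] := rational_generic formS (phi0 false) (phi0 true).
pose g := lie x1 h.
have gE b : [/\ coor b 0 g = 0, coor b 1 g = 0 & coor b 2 g != 0].
  split; rewrite ?coor_lie0 ?coor_lie1 //.
  by case: b; [exact: g2 | exact: g1].
have Sg : S g by apply: Slie.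
have ad_preim w := rational_ad_preimage (w := w) S1 Sg a0 gE.
(* [x3] replaces [h]: it has the same bracket with [x1] but lies in A. *)
have [|x3 [S3 e13 E3]] := ad_preim g Sg; first by move=> b; case: (gE b).
have c0 b : coor b 1 x3 != 0.
  have [_ _] := gE b; rewrite -e13 coor_lie2 E3 mulr0 subr0 mulf_eq0.
  by rewrite negb_or => /andP[].
have [y2 [Sy2 n2 _]] : exists v,
    [/\ S v, coor_det x1 v != 0 & coor_det x1 v != 0].
  by apply: (rational_generic (alpha := coor_det x1) (beta := coor_det x1)
    formS);
    exists (of_coor (fun b _ => if b then 0 else 1));
    rewrite /= /coor_det !of_coorK //= mulr1 mulr0 subr0.
have [||x0 [Sx0 e0 E0]] := ad_preim (lie x1 y2); first by apply: Slie.
  by move=> b; rewrite !coor_lieE.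
(* Subtracting [x0], an element of A, makes the vector commute with [x1] without changing its class
   modulo A. *)
have [x2 [S2 e12 {}n2]] : exists x2, [/\ S x2,
  lie x1 x2 = 0 & coor_det x1 x2 != 0].
  exists (y2 - x0); rewrite lieBr e0 subrr; split=> //; first exact: SB.
  by rewrite linearB /= [coor_det x1 x0]/coor_det !E0 !mulr0 !subr0.
pose t b := coor b 0 x2 / coor b 0 x1.
have tE b : coor b 0 x2 = t b * coor b 0 x1 by rewrite /t mulfVK.
have nt : t false != t true.
  apply: contraNneq n2 => et.
  by rewrite /coor_det !tE et; apply/eqP; ring.
(* The eigenvalues [t b] are the roots of a monic quadratic whose coefficients are their sum and
   minus their product. Written as a relation between vectors of [S], this equation descends to
   rational coefficients. *)
pose u (i : 'I_2) := if i == 0 then lie x1 (lie x1 x3) else lie x2 (lie x1 x3).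
have Su i : S (u i) by rewrite /u; case: ifP => _; do ?apply: (Slie).
have S5 : S (lie x2 (lie x2 x3)) by do ?apply: (Slie).
have [q [q5 _]] : exists q : 'I_2 -> rat,
    \sum_i ratr (q i) *: u i = lie x2 (lie x2 x3) /\
    \sum_i ratr (q i) *: u i = lie x2 (lie x2 x3).
  have eu :
      \sum_i (if i == 0 then - (t false * t true) else t false + t true) *: u i
      = lie x2 (lie x2 x3).
    rewrite !big_ord_recl big_ord0 /u /= addr0.
    apply: coor_ext => b m m4; rewrite linearD !linearZ /= !coor_lie //.
    case: m m4 => [|[|[|[|m]]]] // _ /=; rewrite ?mulr0 ?addr0 //;
    by rewrite ?(coor_lieE, E3, mulr0, mul0r, subr0, addr0, tE); case: b; ring.
  exact: (rational_solution formS Su Su S5 S5 eu eu).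
have tq b : t b ^+ 2 = ratr (q 0) + ratr (q 1) * t b.
  have := congr1 (coor b 3) q5.
  rewrite !big_ord_recl big_ord0 /u /= addr0 linearD !linearZ /= !coor_lieE.
  rewrite !E3 !mulr0 ?mul0r !subr0 !tE.
  have -> : lift ord0 ord0 = 1 :> 'I_2 by apply/val_inj.
  move=> e; apply: (mulIf (c0 b)); apply: (mulIf (a0 b)); apply: (mulIf (a0 b)).
  transitivity (t b * coor b 0 x1 * (t b * coor b 0 x1 * coor b 1 x3));
    first by ring.
  by rewrite -e; ring.
have t1 : t false + t true = ratr (q 1).
  have n0 : t false - t true != 0 by rewrite subr_eq0.
  apply: (mulIf n0); rewrite mulrC -subr_sqr !tq; ring.
(* Removing half the trace [ratr (q 1)] makes the eigenvalues opposite; their common square is a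
   quarter of the discriminant, hence rational. *)
pose tau b := t b - ratr (q 1 / 2)%R.
have ratr2 : @ratr R 2%:R = 2 by rewrite rmorph_nat.
have tauE b : tau b = (-1) ^+ b * ((t false - t true) / 2).
  rewrite /tau fmorph_div /= ratr2 -t1.
  by case: b => /=; rewrite ?expr0 ?expr1; field.
have tau2 b : tau b ^+ 2 = ratr (q 0 + q 1 ^+ 2 / 4)%R.
  have ratr4 : @ratr R 4%:R = 4 by rewrite rmorph_nat.
  rewrite /tau sqrrB tq rmorphD !fmorph_div /= rmorphXn /= ratr2 ratr4.
  by field.
have taun0 b : tau b != 0.
  rewrite tauE mulf_neq0 ?signr_eq0 // mulf_neq0 ?subr_eq0 //.
  by rewrite invr_eq0 pnatr_eq0.
have [|k [m [sk m0 mE]]] := @rat_square_free_part (q 0 + q 1 ^+ 2 / 4)%R.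
  by rewrite -(ltr0q R) -(tau2 false) lt_def sqr_ge0 sqrf_eq0 taun0.
exists k; split=> //.
have rm0 : @ratr R m != 0 by rewrite fmorph_eq0.
(* Dividing by [m] leaves exactly [k] as the square; [x2'] is the rational vector with eigenvalues
   [mu b]. *)
pose mu b := tau b / ratr m.
pose x2' := ratr m^-1 *: (x2 - ratr (q 1 / 2)%R *: x1).
have S2' : S x2' by apply: (SZ); apply: (SB) => //; apply: SZ.
have e12' : lie x1 x2' = 0 by rewrite lieZr lieBr e12 lieZr liexx scaler0
  subr0 scaler0.
have E2 b : coor b 0 x2' = mu b * coor b 0 x1.
  by rewrite linearZ linearB linearZ /= tE fmorphV /mu /tau; field.
(* In [lk k] both [X_1, X_4] and [X_2, X_3] equal Z_2, which dictates the equation for [x4]. *)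
have [||x4 [S4 e14 E4]] := ad_preim (lie x2' x3); first by apply: Slie.
  by move=> b; rewrite !coor_lieE.
have nmu : mu false != mu true.
  rewrite /mu -subr_eq0 -mulrBl mulf_neq0 ?invr_eq0 // subr_eq0.
  by apply: contra nt => /eqP/addIr/eqP.
have muk b : mu b ^+ 2 = k%:R.
  rewrite /mu expr_div_n tau2 mE rmorphM rmorphXn /= rmorph_nat.
  by rewrite mulrAC divff ?mul1r // expf_neq0.
have [] := @lk_relations_coor R k mu x1 x2' x3 x4 nmu muk _ e12' e14.
  by move=> b; split.
set s := [:: _; _; _; _; _; _; _; _] => bs rels.
have [|_] := rat_form_of_lk_relations bs _ rels; first by [].
rewrite -(rat_span_basis formS bs) // => -[i i8] /=.
by case: i i8 => [|[|[|[|[|[|[|[|i]]]]]]]] //= _; do ?apply: (Slie).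
Qed.
End Forms.

(** * The rational subspace spanned by [form_generators] *)

Section Generators.
Variables (R : realType) (L : lieAlgType R) (X1 X2 X3 X4 Z1 Z2 Z3 Z4 : L).
Hypothesis adapted : adapted_basis X1 X2 X3 X4 Z1 Z2 Z3 Z4.
Variable k : nat.
Hypothesis k0 : (0 < k)%N.

Let b := [:: X1; X2; X3; X4; Z1; Z2; Z3; Z4].
Let g := form_generators k X1 X2 X3 X4 Z1 Z2 Z3 Z4.
Let r : R := Num.sqrt k%:R.
Let c i : R := if odd i then r else 1.

Let r2 : r * r = k%:R. Proof. by rewrite -expr2 sqr_sqrtr // ler0n. Qed.
Let r0 : r != 0. Proof. by rewrite sqrtr_eq0 -ltNge ltr0n. Qed.

(** One formula for all eight generators: [i./2] selects the pair of basis vectors, and the parity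
    of [i] the sign and the factor. *)
Let gE i : (i < 8)%N ->
  g`_i = c i *: (b`_(i./2.*2) + (-1) ^+ i *: b`_(i./2.*2).+1).
Proof.
have e (x y : L) : x + y = 1 *: (x + 1 *: y) by rewrite !scale1r.
have o (x y : L) : r *: (x - y) = r *: (x + (-1) *: y) by rewrite scaleN1r.
rewrite -signr_odd.
by case: i => [|[|[|[|[|[|[|[|i]]]]]]]] // _; rewrite /c /=;
  [exact: e|exact: o|exact: e|exact: o|exact: e|exact: o|exact: e|exact: o].
Qed.

(** The parity of an index tells the two copies of [l4] apart, and opposite parities commute. *)
Let lie_b0 i j : (i < 8)%N -> (j < 8)%N ->
  ~~ ((i < 2) && (1 < j < 6) && (odd i == odd j))%N ->
  ~~ ((j < 2) && (1 < i < 6) && (odd i == odd j))%N -> lie b`_i b`_j = 0.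
Proof.
have [_ _ h0] := adapted; move=> i8 j8 nij nji.
have h i' j' : (i' < j' < 8)%N ->
    ~~ ((i' < 2) && (1 < j' < 6) && (odd i' == odd j'))%N -> lie b`_i' b`_j' =
      0.
  move=> ij n; apply: h0 => //; apply: contra n; rewrite !inE.
  by case/or4P => /eqP[-> ->].
case: (ltngtP i j) => ij; first by apply: h; rewrite ?ij.
  by rewrite lieC h ?oppr0 ?ij // eq_sym.
by rewrite ij liexx.
Qed.

(** Cross terms pair indices of opposite parity and vanish, while the signs multiply. The factor [k]
    later arises as [r * r] when both generators are odd. *)
Lemma form_generators_lie i j : (i < 8)%N -> (j < 8)%N ->
  lie g`_i g`_j = (c i * c j) *: (lie b`_(i./2.*2) b`_(j./2.*2) +
    (-1) ^+ (i + j) *: lie b`_(i./2.*2).+1 b`_(j./2.*2).+1).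
Proof.
move=> i8 j8; rewrite !gE // lieZl lieZr scalerA lieDl !lieDr !lieZl !lieZr.
have half8 n : (n < 8)%N -> (n./2.*2.+1 < 8)%N.
  by case: n => [|[|[|[|[|[|[|[|n]]]]]]]].
rewrite [lie b`_(i./2.*2) b`_(_.+1)]lie_b0 ?half8 ?(ltnW (half8 _ _)) //=;
  try by rewrite !odd_double andbF.
rewrite [lie b`_(i./2.*2).+1 b`_(_./2.*2)]lie_b0 ?half8 ?(ltnW (half8 _ _)) //=;
  try by rewrite !odd_double andbF.
by rewrite !scaler0 addr0 add0r scalerA -exprD.
Qed.

Lemma form_generators_relations : lk_relations k g.
Proof.
have [_ [h13 h24 h11 h22] _] := adapted.
split.
- split; rewrite form_generators_lie //= /c /= ?h13 ?h24 ?mulr1 ?mul1r ?r2;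
    rewrite -signr_odd /= ?expr0 ?expr1 ?scaleN1r ?scale1r //.
- split; rewrite form_generators_lie //= /c /= ?h11 ?h22 ?mulr1 ?mul1r ?r2;
    rewrite -signr_odd /= ?expr0 ?expr1 ?scaleN1r ?scale1r //.
- move=> i j /andP[ij j8] nz; rewrite form_generators_lie ?(ltn_trans ij) //.
  have [->|nij] := eqVneq i./2 j./2; first
    by rewrite !liexx scaler0 addr0 scaler0.
  rewrite !lie_b0 ?scaler0 ?addr0 ?scaler0 //; by lia.
Qed.

(** Sums and differences recover the adapted basis, as 2 and [r] are invertible; eight spanning
    vectors in dimension eight form a basis. *)
Lemma form_generators_basis : basis_of fullv g.
Proof.
have [/andP[/eqP sb fb] _ _] := adapted.
rewrite basisEdim; apply/andP; split; last by rewrite -sb (eqP fb).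
rewrite -sb; apply/span_subvP => u ub.
have {ub}[i i8 ->] : exists2 i, (i < 8)%N & u = b`_i.
  by exists (index u b); rewrite ?nth_index // index_mem.
have g_in j : (j < 8)%N -> g`_j \in <<g>>%VS by move=> j8;
  rewrite memv_span ?mem_nth.
have e (x y : L) : x = 2^-1 *: ((x + y) + r^-1 *: (r *: (x - y))).
  rewrite scalerA mulVf // scale1r addrACA subrr addr0 -mulr2n.
  by rewrite -scaler_nat scalerA mulVf ?scale1r // pnatr_eq0.
have o (x y : L) : y = 2^-1 *: ((x + y) - r^-1 *: (r *: (x - y))).
  by rewrite -scalerN -scalerN opprB [x + y]addrC -e.
have E j : (j < 4)%N -> b`_j.*2 \in <<g>>%VS /\ b`_j.*2.+1 \in <<g>>%VS.
  move=> j4.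
  have [-> ->] : b`_j.*2 = 2^-1 *: (g`_j.*2 + r^-1 *: g`_j.*2.+1) /\
        b`_j.*2.+1 = 2^-1 *: (g`_j.*2 - r^-1 *: g`_j.*2.+1).
    by case: j j4 => [|[|[|[|j]]]] // _; split; first [exact: e | exact: o].
  by split; rewrite memvZ ?memvD ?memvN ?memvZ ?g_in //; lia.
have i4 : (i./2 < 4)%N by lia.
have [b_even b_odd] := E _ i4.
by rewrite -[i]odd_double_half; case: (odd i).
Qed.

End Generators.

(** * Uniqueness of the square-free parameter *)

Lemma alt_ext_ebasis (F : fieldType) n (c : nat -> nat -> 'rV[F]_n) (i j :
  nat) :
  (i < n)%N -> (j < n)%N ->
  alt_ext c (ebasis F n i.+1) (ebasis F n j.+1) = c i.+1 j.+1 - c j.+1 i.+1.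
Proof.
move=> i_n j_n; rewrite alt_ext_table (bigD1 (Ordinal i_n)) //=.
rewrite (bigD1 (Ordinal j_n)) //= !mxE !eqxx mulr1 scale1r.
rewrite !big1 ?addr0 // => l nl; last first.
  by rewrite !mxE [l.+1 == _](negPf nl) mulr0 scale0r.
by apply: big1 => m _; rewrite !mxE [l.+1 == _](negPf nl) mul0r scale0r.
Qed.

Section Uniqueness.
Variables (R : realType).
Local Notation L := (l4 R * l4 R)%type.
Variable S : set L.
Hypothesis formS : rational_form S.

(* [mu b] is the eigenvalue of [ad x2] relative to [ad x1] on summand [b]. *)
Lemma lk_isom_coor (k : nat) : rat_lie_isom (lk k%:Z) S ->
  exists (x1 x2 : L) (mu : bool -> R),
  [/\ S x1 /\ S x2, mu false != mu true /\ forall b, mu b ^+ 2 = k%:R,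
    forall b, coor b 0 x1 != 0 /\ coor b 0 x2 = mu b * coor b 0 x1
  & forall v, S v -> exists p q : rat, forall b,
     coor b 0 v = (ratr p + ratr q * mu b) * coor b 0 x1].
Proof.
move=> [f [f_lin f_lie f_inj range_f]].
have Sf u : S (f u) by rewrite -range_f; exists u.
have f0 := semilinear0 f_lin; have fZ := semilinearZ f_lin.
(* Numbering starts from 0, so [e 4], ..., [e 7] are the images of Z_1, ..., Z_4. *)
pose e i := f (ebasis rat 8 i.+1).
have fE u : f u = \sum_(i < 8) ratr (u 0 i) *: e i.
  rewrite -(semilinear_sum f_lin); congr f; apply/rowP => j;
    rewrite summxE (bigD1 j) //= !mxE eqxx mulr1.
  rewrite big1 ?addr0 // => i ij; rewrite !mxE eqSS.
  by rewrite [_ == _](negPf _) ?mulr0 // eq_sym.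
have lie_e i j : (i < 8)%N -> (j < 8)%N -> lie (e i) (e j) =
    f (lk_table k i.+1 j.+1 - lk_table k j.+1 i.+1).
  by move=> i8 j8; rewrite -f_lie; congr f; apply: alt_ext_ebasis.
pose s := mkseq e 8.
have bs : basis_of fullv s.
  rewrite basisEdim dim_l4l4 size_mkseq andbT; apply/subvP => v _.
  case: formS => _ _ _ /(_ v)[t [tS]]; apply: subvP; apply/span_subvP => u /tS.
  rewrite -range_f => -[w _ <-]; rewrite fE memv_suml // => i _; apply: memvZ.
  by apply: memv_span; apply/mapP; exists (val i) => //; rewrite mem_iota;
    case: i.
have lie04 : lie (e 0) (e 4) = e 6 by rewrite lie_e //= subr0.
have lie05 : lie (e 0) (e 5) = e 7 by rewrite lie_e //= subr0.
have lie14 : lie (e 1) (e 4) = e 7 by rewrite lie_e //= subr0.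
have lie15 : lie (e 1) (e 5) = k%:R *: e 6.
  by rewrite lie_e //= subr0 fZ ratr_int.
have lie02 : lie (e 0) (e 2) = e 4 by rewrite lie_e //= subr0.
have lie03 : lie (e 0) (e 3) = e 5 by rewrite lie_e //= subr0.
have liei4 i : (1 < i < 8)%N -> lie (e i) (e 4) = 0.
  move=> /andP[i1 i8]; rewrite lie_e // -f0; congr f.
  by case: i i1 i8 => [|[|[|[|[|[|[|[|i]]]]]]]] //= _ _; rewrite subrr.
have E4 b : coor b 0 (e 4) = 0 by rewrite -lie02 coor_lie0.
have E5 b : coor b 0 (e 5) = 0 by rewrite -lie03 coor_lie0.
have E41 b : coor b 1 (e 4) = 0 by rewrite -lie02 coor_lie1.
have E51 b : coor b 1 (e 5) = 0 by rewrite -lie03 coor_lie1.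
have E6 b : coor b 3 (e 6) = coor b 0 (e 0) * coor b 2 (e 4).
  by rewrite -lie04 coor_lie3 E4 mulr0 subr0.
have E7 b : coor b 3 (e 7) = coor b 0 (e 1) * coor b 2 (e 4).
  by rewrite -lie14 coor_lie3 E4 mulr0 subr0.
have E7' b : coor b 3 (e 7) = coor b 0 (e 0) * coor b 2 (e 5).
  by rewrite -lie05 coor_lie3 E5 mulr0 subr0.
have E6' b : k%:R * coor b 3 (e 6) = coor b 0 (e 1) * coor b 2 (e 5).
  by have := congr1 (coor b 3) lie15; rewrite linearZ coor_lie3 E5 mulr0 subr0.
(* [e 6] and [e 7] are supported on coordinate 3, so their independence is that of two vectors of
   R^2, with determinant [D] below. *)
have ext67 (x y : R) :
    (forall b, x * coor b 3 (e 6) + y * coor b 3 (e 7) = 0) -> x = 0 /\ y = 0.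
  move=> xy; pose a (i : 'I_(size s)) :=
    if i == 6 :> nat then x else if i == 7 :> nat then y else 0.
  have a0 : \sum_(i < size s) a i *: s`_i = 0.
    rewrite (_ : size s = 8) // in a *.
    rewrite -(big_mkord xpredT (fun i =>
      (if i == 6 then x else if i == 7 then y else 0) *: s`_i)).
    rewrite unlock /= !scale0r !add0r addr0.
    apply: coor_ext => b m m4; rewrite linear0 linearD !linearZ /=.
    case: m m4 => [|[|[|[|m]]]] // _; rewrite -?lie04 -?lie05 ?coor_lieE ?E4
      ?E5 ?E41 ?E51;
      rewrite ?mulr0 ?subrr ?mulr0 ?addr0 //.
  have fa := free_sum0 (basis_free bs) a0.
  by split; [have := fa (@Ordinal 8 6 isT)|have := fa (@Ordinal 8 7 isT)].
pose D := coor false 3 (e 6) * coor true 3 (e 7) -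
  coor true 3 (e 6) * coor false 3 (e 7).
have D0 : D != 0.
  apply/eqP => D0.
  have [|t7 t6] := ext67 (coor true 3 (e 7)) (- coor true 3 (e 6)).
    by case; [ring|rewrite -[RHS]D0 /D; ring].
  have [|f7 f6] := ext67 (coor false 3 (e 7)) (- coor false 3 (e 6)).
    by case; [rewrite -[RHS]oppr0 -D0 /D; ring|ring].
  have [|] := ext67 1 1; last by move=> /eqP; rewrite oner_eq0.
  move/eqP: t6; rewrite oppr_eq0 => /eqP t6.
  move/eqP: f6; rewrite oppr_eq0 => /eqP f6.
  by case; rewrite ?t6 ?t7 ?f6 ?f7 mulr0 addr0.
pose x (i : nat) b := coor b 0 (e i); pose g b := coor b 2 (e 4).
(* [D] factors through the class determinant of [e 0] and [e 1], so every factor is nonzero. *)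
have {D0}[g0 dx] : (forall b, g b != 0) /\
    x 0 false * x 1 true - x 0 true * x 1 false != 0.
  have : D = g true * g false * (x 0 false * x 1 true - x 0 true * x 1 false).
    by rewrite /D !E6 !E7 /x /g; ring.
  by move=> DE; move: D0; rewrite DE !mulf_eq0 !negb_or => /andP[/andP[? ?] ?];
    split=> // -[].
(* Compare the two expressions for [X_1, Z_2] = [X_2, Z_1], then use [X_2, Z_2] = k Z_3. *)
have sq b : x 1 b ^+ 2 = k%:R * x 0 b ^+ 2.
  apply: (mulIf (g0 b)).
  have e1 : x 0 b * coor b 2 (e 5) = x 1 b * g b by rewrite -[RHS]E7 E7'.
  have e2 : k%:R * (x 0 b * g b) = x 1 b * coor b 2 (e 5) by rewrite -E6' E6.
  rewrite expr2 -mulrA -e1 mulrCA -e2; ring.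
have x0 b : x 0 b != 0.
  apply: contraNneq dx => xb; have := sq b; rewrite xb expr0n mulr0 => /eqP.
  rewrite sqrf_eq0 => /eqP xb1.
  by move: xb xb1; case: b => -> ->; rewrite !(mul0r, mulr0) subrr.
exists (e 0), (e 1), (fun b => x 1 b / x 0 b); split.
- by split; apply: Sf.
- split=> [|b]; last by rewrite expr_div_n sq mulfK // expf_neq0.
  apply: contra dx => /eqP exy; rewrite -(divfK (x0 true) (x 1 true)) -exy.
  by rewrite -[X in _ - _ * X](divfK (x0 false)); apply/eqP; ring.
- by move=> b; split; [exact: x0 | rewrite divfK // x0].
move=> v; rewrite -range_f => -[u _ <-]; rewrite fE.
exists (u 0 (@Ordinal 8 0 isT)), (u 0 (@Ordinal 8 1 isT)) => b.
rewrite linear_sum (bigD1 (@Ordinal 8 0 isT)) //=.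
rewrite (bigD1 (@Ordinal 8 1 isT)) //=.
(* All of [e 2], ..., [e 7] commute with [e 4], whose coordinate 2 is nonzero in both summands, so
   their coordinate 0 is zero. *)
rewrite big1 ?addr0 ?linearZ /=; last first.
  case=> i i8 /= /andP[i0 i1]; rewrite linearZ /=.
  have : coor b 3 (lie (e i) (e 4)) = 0 by rewrite liei4 ?linear0 // i8;
    case: i i8 i0 i1 => [|[]].
  rewrite coor_lie3 E4 mulr0 subr0 => /eqP;
    rewrite mulf_eq0 (negPf (g0 b)) orbF => /eqP ->.
  exact: mulr0.
by rewrite -/(x 0 b) -/(x 1 b) mulrDl -[in RHS]mulrA divfK.
Qed.

Lemma lk_isom_unique (k k' : nat) : square_free k -> square_free k' ->
  rat_lie_isom (lk k%:Z) S -> rat_lie_isom (lk k'%:Z) S -> k = k'.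
Proof.
move=> sk sk' /lk_isom_coor[x1 [x2 [mu [_ [nmu muk] xE cS]]]].
move=> /lk_isom_coor[y1 [y2 [nu [[Sy1 Sy2] [nnu nuk] yE _]]]].
have opp (w : bool -> R) (n : nat) : w false != w true -> (forall b,
  w b ^+ 2 = n%:R) ->
    w true = - w false.
  move=> nw wn; have /eqP := wn true; rewrite -(wn false) eqf_sqr eq_sym
    (negPf nw).
  by move/eqP.
have mut := opp _ _ nmu muk; have nut := opp _ _ nnu nuk.
have [q1 [q2 qE]] := cS _ Sy1; have [p1 [p2 pE]] := cS _ Sy2.
(* Thus [nu] is the image of [mu] under a rational Moebius transformation. *)
have e b : ratr p1 + ratr p2 * mu b = nu b * (ratr q1 + ratr q2 * mu b).
  have [x0 _] := xE b; have [_ y2E] := yE b.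
  by apply: (mulIf x0); rewrite -pE y2E qE mulrA.
pose w := nu false * mu false.
have n2 : (2 : R) != 0 by rewrite pnatr_eq0.
(* Since [mu] and [nu] change sign with [b], adding the two equations gives [e1] and subtracting
   them gives [e2]. *)
have e1 : ratr p1 = w * ratr q2.
  apply: (mulfI n2).
  transitivity (ratr p1 + ratr p2 * mu false + (ratr p1 + ratr p2 * mu true)).
    by rewrite mut; ring.
  by rewrite !e mut nut /w; ring.
have e2 : k%:R * ratr p2 = w * ratr q1.
  apply: (mulfI n2); rewrite -(muk false).
  transitivity (mu false * (ratr p1 + ratr p2 * mu false - (ratr p1 + ratr p2
    * mu true))).
    by rewrite mut; ring.
  by rewrite !e mut nut /w; ring.
(* At least one of [q1] and [q2] is nonzero, as otherwise [coor false 0 y1] would vanish. *)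
have [q wq] : exists q, w = ratr q.
  have [q20|q20] := eqVneq q2 0; last first.
    exists (p1 / q2); rewrite fmorph_div /= e1 mulfK //.
    by rewrite fmorph_eq0.
  exists (k%:R * p2 / q1); rewrite fmorph_div rmorphM /= rmorph_nat e2 mulfK //.
  rewrite fmorph_eq0; apply/eqP => q10; have [/eqP[]] := yE false.
  by rewrite qE q10 q20 rmorph0 mul0r addr0 mul0r.
apply: (square_free_mul_square (q := q)) => //.
apply: (@fmorph_inj _ _ (@ratr R)); rewrite rmorphM rmorphXn /= !rmorph_nat -wq.
by rewrite /w exprMn muk nuk mulrC.
Qed.

End Uniqueness.

(** * An explicit adapted basis, and the classification *)

Lemma adapted_basis_exists (F : fieldType) :
  exists X1 X2 X3 X4 Z1 Z2 Z3 Z4 : (l4 F * l4 F)%type,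
    adapted_basis X1 X2 X3 X4 Z1 Z2 Z3 Z4.
Proof.
(* Index 2m + b stands for Y_(m+1) in summand [b], which gives the order X_1, ..., X_4, Z_1, ...,
   Z_4. *)
pose E i : (l4 F * l4 F)%type := of_coor (fun b m => (i == m.*2 + b)%N%:R).
have coorE b m i : (m < 4)%N -> coor b m (E i) = (i == m.*2 + b)%N%:R.
  exact: of_coorK.
exists (E 0), (E 1), (E 2), (E 3), (E 4), (E 5), (E 6), (E 7).
have nE i : (i < 8)%N -> [:: E 0; E 1; E 2; E 3; E 4; E 5; E 6; E 7]`_i = E i.
  by case: i => [|[|[|[|[|[|[|[|i]]]]]]]].
split.
- apply: basis_l4l4 => // k e i; have i4 : (i./2 < 4)%N by case: i => /= i; lia.
  rewrite -[RHS](e (odd i) _ i4) (bigD1 i) //= nE // coorE // addnC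
    odd_double_half.
  rewrite eqxx mulr1 big1 ?addr0 // => j ji;
    rewrite nE // coorE // addnC odd_double_half.
  by rewrite [_ == _](negPf ji) mulr0.
- split; apply: coor_ext => b m m4; rewrite coor_lie // !coorE //;
    by case: b; case: m m4 => [|[|[|[|m]]]] //= _;
      rewrite ?mulr0 ?mulr1 ?mul0r ?subr0.
- move=> i j /andP[ij j8] nij; rewrite !nE ?(ltn_trans ij) //.
  apply: coor_ext => b m m4; rewrite coor_lie // !coorE // linear0.
  have nat0 p q p' q' : (p * q = 0 /\ p' * q' = 0)%N ->
      p%:R * q%:R - p'%:R * q'%:R = 0 :> F.
    by rewrite -!natrM => -[-> ->]; rewrite subrr.
  case: m m4 => [|[|[|[|m]]]] //= _; apply: nat0;
    by move: nij; rewrite !inE !xpair_eqE; case: b; lia.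
Qed.

(** The first clause shows that the second is not vacuous; the third, that every square-free [k]
    occurs, follows by applying the second to the explicit basis. *)
Theorem theorem2p14 (R : realType) :
  [/\ exists X1 X2 X3 X4 Z1 Z2 Z3 Z4 : (l4 R * l4 R)%type,
        adapted_basis X1 X2 X3 X4 Z1 Z2 Z3 Z4,
      forall X1 X2 X3 X4 Z1 Z2 Z3 Z4 : (l4 R * l4 R)%type,
        adapted_basis X1 X2 X3 X4 Z1 Z2 Z3 Z4 ->
        forall k : nat, (0 < k)%N ->
        let S := rat_span (form_generators k X1 X2 X3 X4 Z1 Z2 Z3 Z4) in
        rational_form S /\ rat_lie_isom (lk k%:Z) S,
      forall k : nat, square_free k ->
        exists S : set (l4 R * l4 R)%type,
          rational_form S /\ rat_lie_isom (lk k%:Z) S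
    & forall S : set (l4 R * l4 R)%type, rational_form S ->
        exists! k : nat, square_free k /\ rat_lie_isom (lk k%:Z) S].
Proof.
have forms X1 X2 X3 X4 Z1 Z2 Z3 Z4 : @adapted_basis R (l4 R * l4 R)%type X1 X2
  X3 X4 Z1 Z2 Z3 Z4 ->
    forall k : nat, (0 < k)%N ->
    let S := rat_span (form_generators k X1 X2 X3 X4 Z1 Z2 Z3 Z4) in
    rational_form S /\ rat_lie_isom (lk k%:Z) S.
  move=> ad k k0 S; apply: rat_form_of_lk_relations => //.
    exact: form_generators_basis.
  exact: form_generators_relations.
split=> //; first exact: adapted_basis_exists.
- move=> k [k0 _]; have [X1 [X2 [X3 [X4 [Z1 [Z2 [Z3 [Z4 ad]]]]]]]] :=
    adapted_basis_exists R.
  by exists (rat_span (form_generators k X1 X2 X3 X4 Z1 Z2 Z3 Z4));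
    apply: forms.
- move=> S formS; have [k [sk isok]] := rational_form_isom formS.
  by exists k; split=> // k' [sk' isok']; apply: (lk_isom_unique formS).
Qed.
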